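(* Let $X$ and $Y$ be connected weighted graphs with possible loops, and let $u$ and $v$ be vertices of $X$ that are strongly cospectral with respect to $M(X)$, where $M=\mathbf{A}$ or $M=\mathcal{A}$. For a vertex $w$ of $Y$ and every eigenvalue $\mu$ of $\mathbf{A}(X\square Y)$ (resp., $\mathcal{A}(X\times Y)$), let $\Lambda_\mu$ be the set of all $\lambda\in\sigma_u(\mathbf{A}(X))$ (resp., $\sigma_u(\mathcal{A}(X))$) and $\Theta_\mu$ be the set of all $\theta\in\sigma_w(\mathbf{A}(Y))$ (resp., $\sigma_w(\mathcal{A}(Y))$) such that $\mu+\alpha=\lambda+\theta$ (resp., $\mu=\lambda\theta$). 1. Let $M(X)=\mathbf{A}(X)$. For any vertex $w$ in $Y$, $(u,w)$ and $(v,w)$ are strongly cospectral with respect to $\mathbf{A}(X\square Y)$ if and only if for any eigenvalue $\mu$ of $\mathbf{A}(X\square Y)$, one of the following holds. (a) For some $\lambda\in\sigma(\mathbf{A}(X))$ and $\theta\in\sigma(\mathbf{A}(Y))$, $\mu+\alpha=\lambda+\theta\neq\lambda'+\theta'$ for any $\lambda'\in\sigma(\mathbf{A}(X))$ and $\theta'\in\sigma(\mathbf{A}(Y))$ such that $\lambda\neq\lambda'$ and $\theta\neq\theta'$. (b) Either $E_\lambda\mathbf{e}_u=E_\lambda\mathbf{e}_v$ for all $\lambda\in\Lambda_\mu$, or $E_\lambda\mathbf{e}_u=-E_\lambda\mathbf{e}_v$ for all $\lambda\in\Lambda_\mu$. 2. Let $M(X)=\mathcal{A}(X)$ and let $X$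 and $Y$ be simple. For any vertex $w$ in $Y$, $(u,w)$ and $(v,w)$ are strongly cospectral with respect to $\mathcal{A}(X\times Y)$ if and only if for any eigenvalue $\mu$ of $\mathcal{A}(X\times Y)$, either (a) for some $\lambda\in\sigma(\mathcal{A}(X))$ and $\theta\in\sigma(\mathcal{A}(Y))$, $\frac{1}{\gamma}\mu-\alpha\gamma=(\lambda-\alpha)(\theta-\alpha)\neq(\lambda'-\alpha)(\theta'-\alpha)$ for any $\lambda'\in\sigma(\mathcal{A}(X))$ and $\theta'\in\sigma(\mathcal{A}(Y))$ such that $\lambda\neq\lambda'$ and $\theta\neq\theta'$, or (b) either $E_\lambda\mathbf{e}_u=E_\lambda\mathbf{e}_v$ for all $\lambda\in\Lambda_\mu$, or $E_\lambda\mathbf{e}_u=-E_\lambda\mathbf{e}_v$ for all $\lambda\in\Lambda_\mu$. 3. If we add (to the hypotheses of part 1, resp., part 2) that $w$ and $z$ are vertices of $Y$ that are strongly cospectral with respect to $M(Y)$, then $(u,w)$ and $(v,z)$ are strongly cospectral with respect to $\mathbf{A}(X\square Y)$ (resp., $\mathcal{A}(X\times Y)$) if and only if for every eigenvalue $\mu$ of $\mathbf{A}(X\square Y)$ (resp., $\mathcal{A}(X\times Y)$), either (a) $E_\lambda\mathbf{e}_u\otimes E_\theta\mathbf{e}_w=E_\lambda\mathbf{e}_v\otimes E_\theta\mathbf{e}_z$ for all $\lambda\in\Lambda_\mu$ and $\theta\in\Theta_\mu$, or (b) $E_\lambda\mathbf{e}_u\otimes E_\theta\mathbf{e}_w=-E_\lambda\mathbf{e}_v\otimes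 E_\theta\mathbf{e}_z$ for all $\lambda\in\Lambda_\mu$ and $\theta\in\Theta_\mu$.
   Context: Graphs are finite undirected with nonzero real edge weights, loops allowed, no multiple edges; simple means no loops. $A(X)$ is the adjacency matrix: $(A(X))_{j,\ell}$ is the weight of the edge $(j,\ell)$ (for $j=\ell$, of the loop at $j$), and $0$ if there is none. $\deg(u)=2(A)_{u,u}+\sum_{j\neq u}(A)_{u,j}$ and $D(X)$ is the diagonal matrix of degrees. Fix real $\alpha,\beta,\gamma$ with $\gamma\neq0$, the same for all graphs. $\mathbf{A}(X)=\alpha I+\beta D(X)+\gamma A(X)$. If all vertex degrees are positive or all are negative, $\mathcal{A}(X)=\alpha I+\gamma D(X)^{-1/2}A(X)D(X)^{-1/2}$, where $D(X)^{-1/2}$ is diagonal with entries $1/\sqrt{\deg(u)}$ if $\deg(u)>0$ and $-i/\sqrt{|\deg(u)|}$ if $\deg(u)<0$; whenever $\mathcal{A}$ of a graph is used it is assumed to be defined. These matrices are real symmetric. $\sigma(N)$ is the spectrum of $N$. For an eigenvalue $\lambda$ of a real symmetric matrix $N$, $E_\lambda$ denotes the orthogonal projection onto its eigenspace (the matrix $N$ being that of $X$ for $\lambda$ and that of $Y$ for $\theta$). $\sigma_u(N)=\{\lambda:E_\lambda\mathbf{e}_u\neq0\}$, where $\mathbf{e}_u$ is the characteristic vector of $u$. Vertices $u,v$ are strongly cospectral with respect to $N$ if for each eigenvalue $\lambda$ of $N$, $E_\lambda\mathbf{e}_u=E_\lambda\mathbf{e}_v$ or $E_\lambda\mathbf{e}_u=-E_\lambda\mathbf{e}_v$.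 The Cartesian product $X\square Y$ has vertex set $V(X)\times V(Y)$, with $(u,x)$ and $(v,y)$ adjacent when $x=y$ and $(u,v)$ is an edge of $X$ (with that weight) or $u=v$ and $(x,y)$ is an edge of $Y$ (with that weight), the loop weights at $u$ and $x$ being added at $(u,x)$; thus $A(X\square Y)=A(X)\otimes I+I\otimes A(Y)$ and $D(X\square Y)=D(X)\otimes I+I\otimes D(Y)$. The direct product $X\times Y$ has vertex set $V(X)\times V(Y)$, with $(u,x)$ and $(v,y)$ adjacent when $(u,v)$ and $(x,y)$ are edges of $X$ and $Y$, with weight the product of their weights; $A(X\times Y)=A(X)\otimes A(Y)$. The characteristic vector of $(u,w)$ is $\mathbf{e}_u\otimes\mathbf{e}_w$.
   Formalization: For X×Y, the relation in 2(a) and in Λ_μ, Θ_μ is γμ−αγ=(λ−α)(θ−α), not μ/γ−αγ=… or μ=λθ; in 2(a) ''λ≠λ′ and θ≠θ′'' is read with ''or''; in part 3, (a) and (b) range only over λ∈Λ_μ, θ∈Θ_μ that together satisfy the relation. *)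

(* Defs.v *)
From mathcomp Require Import all_boot all_order all_algebra.
From mathcomp Require Import reals.
From mathcomp Require Import complex mxtens.

Set Implicit Arguments.
Unset Strict Implicit.
Unset Printing Implicit Defensive.

Import Order.TTheory GRing.Theory Num.Theory.
Local Open Scope ring_scope.

(* Vectors are row vectors and operators act on the right, as in MathComp;    *)
(* for the symmetric matrices considered here this is the transpose of the    *)
(* column convention.  Matrices attached to a graph with vertex type V are    *)
(* indexed by 'I_#|V| through enum_val / enum_rank.                           *)

(* There is an edge (a loop when u = v) between u and v iff weight u v != 0. *)
Record wgraph (R : realType) (V : finType) := WGraph {
  weight :> V -> V -> R;
  weightC : forall u v, weight u v = weight v u }.

Section Graphs.
Variables (R : realType) (V : finType).
Implicit Types (X : wgraph R V) (u v : V).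

Definition edge X : rel V := [rel u v | X u v != 0].

Definition graph_connected X : Prop := forall u v, connect (edge X) u v.

Definition simple_graph X : Prop := forall u, X u u = 0.

Definition deg X u : R := 2 * X u u + \sum_(j | j != u) X u j.

Definition adjmx X : 'M[R]_#|V| :=
  \matrix_(i, j) X (enum_val i) (enum_val j).

Definition degmx X : 'M[R]_#|V| :=
  diag_mx (\row_i deg X (enum_val i)).

Definition genadjmx (alpha beta gamma : R) X : 'M[R]_#|V| :=
  alpha%:M + beta *: degmx X + gamma *: adjmx X.

Definition degrees_same_sign X : Prop :=
  (forall u, 0 < deg X u) \/ (forall u, deg X u < 0).

Definition inv_sqrt_deg X u : R[i] :=
  if 0 < deg X u then ((Num.sqrt (deg X u))^-1)%:C%C
  else (- 'i * ((Num.sqrt `|deg X u|)^-1)%:C)%C.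

Definition inv_sqrt_degmx X : 'M[R[i]]_#|V| :=
  diag_mx (\row_i inv_sqrt_deg X (enum_val i)).

Definition cnormadjmx (alpha gamma : R) X : 'M[R[i]]_#|V| :=
  (alpha%:C%C)%:M +
  gamma%:C%C *: (inv_sqrt_degmx X *m map_mx (real_complex R) (adjmx X)
                                  *m inv_sqrt_degmx X).

(* When all degrees have the same sign the entries of cnormadjmx are real, so *)
(* nothing is lost by taking real parts: see normadjmxE.                      *)
Definition normadjmx (alpha gamma : R) X : 'M[R]_#|V| :=
  map_mx (@complex.Re R) (cnormadjmx alpha gamma X).

Lemma normadjmxE (alpha gamma : R) X : degrees_same_sign X ->
  map_mx (real_complex R) (normadjmx alpha gamma X) = cnormadjmx alpha gamma X.
Proof.
move=> sX; apply/matrixP => i j; rewrite mxE [normadjmx _ _ _ _ _]mxE.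
have -> : cnormadjmx alpha gamma X i j = (alpha *+ (i == j) +
    gamma * (X (enum_val i) (enum_val j) *
      ((if 0 < deg X (enum_val i) then 1 else -1) *
       (Num.sqrt `|deg X (enum_val i)|)^-1 *
       (Num.sqrt `|deg X (enum_val j)|)^-1)))%:C%C; last by [].
rewrite rmorphD rmorphMn !rmorphM.
rewrite /cnormadjmx /inv_sqrt_degmx mul_mx_diag mul_diag_mx !mxE.
congr (_ + _ * _); rewrite mulrAC mulrC; congr (_ * _).
rewrite /inv_sqrt_deg; case: sX => sX.
  by rewrite !sX !gtr0_norm // rmorph1 mul1r.
by rewrite !ltNge !ltW //= mulrACA mulrNN -expr2 sqr_i rmorphN1 mulrA.
Qed.

End Graphs.

Section Products.
Variables (R : realType) (VX VY : finType).
Variables (X : wgraph R VX) (Y : wgraph R VY).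

Definition cartesian_weight (p q : VX * VY) : R :=
  (if p.2 == q.2 then X p.1 q.1 else 0) + (if p.1 == q.1 then Y p.2 q.2 else 0).

Lemma cartesian_weightC p q : cartesian_weight p q = cartesian_weight q p.
Proof.
by rewrite /cartesian_weight [q.2 == _]eq_sym [q.1 == _]eq_sym weightC
  [Y _ _]weightC.
Qed.

Definition cartesian_product : wgraph R (VX * VY)%type :=
  WGraph cartesian_weightC.

Definition direct_weight (p q : VX * VY) : R := X p.1 q.1 * Y p.2 q.2.

Lemma direct_weightC p q : direct_weight p q = direct_weight q p.
Proof. by rewrite /direct_weight weightC [Y _ _]weightC. Qed.

Definition direct_product : wgraph R (VX * VY)%type := WGraph direct_weightC.

Lemma deg_direct (p : VX * VY) : simple_graph X -> simple_graph Y ->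
  deg direct_product p = deg X p.1 * deg Y p.2.
Proof.
have degE (W : finType) (Z : wgraph R W) z : simple_graph Z ->
    deg Z z = \sum_j Z z j.
  by move=> sZ; rewrite /deg [RHS](bigD1 z) //= sZ mulr0.
move=> sX sY; have sXY : simple_graph direct_product.
  by move=> q; rewrite /= /direct_weight sX mul0r.
rewrite !degE // big_distrlr pair_big /=.
by apply: eq_bigr.
Qed.

(* So the normalized matrix of the direct product of simple graphs is defined *)
(* as soon as those of the factors are.                                       *)
Lemma direct_degrees_same_sign : simple_graph X -> simple_graph Y ->
  degrees_same_sign X -> degrees_same_sign Y ->
  degrees_same_sign direct_product.
Proof.
move=> sX sY [pX|nX] [pY|nY]; [left|right|right|left] => p; rewrite deg_direct //.
- exact: mulr_gt0.
- by rewrite pmulr_rlt0.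
- by rewrite nmulr_rlt0.
- by rewrite nmulr_rgt0.
Qed.

End Products.

Section Spectral.
Variable R : realType.

(* The orthogonal projection onto the eigenspace of N for lam: kermx W^T is   *)
(* the orthogonal complement of the row space of W.                           *)
Definition eigenproj n (N : 'M[R]_n) (lam : R) : 'M[R]_n :=
  let W := eigenspace N lam in proj_mx W (kermx W^T).

Lemma eigenproj_sym n (N : 'M[R]_n) lam :
  (eigenproj N lam)^T = eigenproj N lam.
Proof.
rewrite /eigenproj; move: (eigenspace N lam) => W; set E := proj_mx _ _.
have cap0 : (W :&: kermx W^T)%MS = 0.
  apply/eqP; rewrite -submx0; apply/rV_subP => x; rewrite sub_capmx submx0.
  case/andP=> /submxP[y xyW] /sub_kermxP xW0.
  have: x *m x^T = 0 by rewrite {2}xyW trmx_mul mulmxA xW0 mul0mx.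
  move/matrixP/(_ 0 0); rewrite !mxE => /eqP.
  under eq_bigr do rewrite [(_^T)%R _ _]mxE -expr2.
  rewrite psumr_eq0 => [/allP x0|i _]; last exact: sqr_ge0.
  apply/eqP/rowP => k; rewrite [RHS]mxE; apply/eqP.
  by rewrite -sqrf_eq0; apply: x0; rewrite mem_index_enum.
have full : (1%:M <= W + kermx W^T)%MS.
  rewrite sub1mx /row_full; apply/eqP.
  move: (mxrank_sum_cap W (kermx W^T)); rewrite cap0 mxrank0 addn0 => ->.
  by rewrite mxrank_ker mxrank_tr subnKC // rank_leq_row.
have /submxP[D ED] : (E <= W)%MS by rewrite -[E]mul1mx proj_mx_sub.
have /sub_kermxP E1W : (1%:M - E <= kermx W^T)%MS.
  by rewrite -[X in (_ - X)%R]mul1mx proj_mx_compl_sub.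
have EE : E^T = E *m E^T.
  apply/eqP; rewrite -subr_eq0 -{1}[E^T]mul1mx -mulmxBl.
  by rewrite {2}ED trmx_mul mulmxA E1W mul0mx.
have: (E *m E^T)^T = E *m E^T by rewrite trmx_mul trmxK.
by rewrite -EE trmxK.
Qed.

Variable V : finType.
Implicit Types (N : 'M[R]_#|V|) (u v : V) (lam : R).

Definition charvec u : 'rV[R]_#|V| := delta_mx 0 (enum_rank u).

Definition eproj N lam u : 'rV[R]_#|V| := charvec u *m eigenproj N lam.

Definition eigsupp N u lam : bool := eigenvalue N lam && (eproj N lam u != 0).

Definition strongly_cospectral N u v : Prop :=
  forall lam, eigenvalue N lam ->
    eproj N lam u = eproj N lam v \/ eproj N lam u = - eproj N lam v.

End Spectral.

(* The two ways an eigenvalue mu of the product arises from eigenvalues lam   *)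
(* and theta of the factors.  For the normalized matrix, N = alpha I + gamma S*)
(* and S of X x Y is the Kronecker product of those of X and Y, whence        *)
(* gamma (mu - alpha) = (lam - alpha) (theta - alpha).                        *)
Definition cartesian_rel (R : realType) (alpha mu lam theta : R) : Prop :=
  mu + alpha = lam + theta.

Definition direct_rel (R : realType) (alpha gamma mu lam theta : R) : Prop :=
  gamma * mu - alpha * gamma = (lam - alpha) * (theta - alpha).

Section PartnerSets.
Variables (R : realType) (VX VY : finType).
Variables (NX : 'M[R]_#|VX|) (NY : 'M[R]_#|VY|) (u : VX) (w : VY).
Variable rel : R -> R -> Prop.

(* With rel := cartesian_rel alpha mu or direct_rel alpha gamma mu these are  *)
(* Lambda_mu and Theta_mu.                                                    *)
Definition Lambda (lam : R) : Prop :=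
  eigsupp NX u lam /\ exists2 theta, eigsupp NY w theta & rel lam theta.

Definition Theta (theta : R) : Prop :=
  eigsupp NY w theta /\ exists2 lam, eigsupp NX u lam & rel lam theta.

End PartnerSets.

(* Main.v *)
Require Import Defs.
From mathcomp Require Import all_boot all_order all_algebra.
From mathcomp Require Import reals.
From mathcomp Require Import complex mxtens.
From mathcomp Require Import ring.

Set Implicit Arguments.
Unset Strict Implicit.
Unset Printing Implicit Defensive.

Import Order.TTheory GRing.Theory Num.Theory.
Local Open Scope ring_scope.

(** All the equivalences rest on one fact about three symmetric matrices [NX], [NY] and
    [N], where [N] acts on the tensor product of the spaces of [NX] and [NY].
    Suppose that whenever [x] and [y] are eigenvectors of [NX] and [NY] for
    [lam] and [theta], [x (x) y] is an eigenvector of [N] for a number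
    [f lam theta].  For the Cartesian product
    [f lam theta = lam + theta - alpha], because
    [A(X [] Y) = A(X) (x) 1 + 1 (x) A(Y) - alpha]; for the direct product
    [f lam theta = alpha + (lam - alpha) (theta - alpha) / gamma], because
    degrees multiply and hence the matrix [(calA - alpha) / gamma] of the
    product is the Kronecker product of those of the factors
    ([genadjmx_cartesian], [normadjmx_direct]).

    By the real spectral theorem ([sum_eigenproj]) the projections
    [E_lam (x) E_theta] add up to the identity, and the eigenprojection [E_mu]
    of [N] keeps those with [f lam theta = mu] and kills the others
    ([eigenproj_kron]).  Hence an identity
    [E_mu e_(u,w) = c E_mu e_(v,z)] holds if and only if its components
    [E_lam e_u (x) E_theta e_w = c (E_lam e_v (x) E_theta e_z)] hold for all
    [lam], [theta] with [f lam theta = mu] ([eproj_pair_eq]).  Strong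
    cospectrality is the case [c = 1] or [c = -1] for every [mu].

    It remains to discard the components that vanish.  If [u] and [v] are
    strongly cospectral, [E_lam e_u] and [E_lam e_v] vanish together, so only
    pairs from the supports of [u] and [w] matter: those are the sets [Lambda]
    and [Theta] ([pair_eq_Lambda_Theta]).  When [w = z] the nonzero factor
    [E_theta e_w] cancels, leaving a condition on [Lambda] only
    ([pair_eq_Lambda]).  Alternative (a) of the first two parts says that at
    most one [lam] can lie in [Lambda], and then the sign that relates
    [E_lam e_u] and [E_lam e_v] serves for all of [Lambda]; so (a) implies (b),
    which is equivalent to strong cospectrality. *)

(** * Eigenprojections of a real symmetric matrix *)

Section SymmetricMatrices.
Variables (R : realType) (n : nat) (N : 'M[R]_n).
Hypothesis symN : N^T = N.

Lemma row_mul_tr_eq0 (x : 'rV[R]_n) : x *m x^T = 0 -> x = 0.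
Proof.
move=> /matrixP/(_ 0 0); rewrite !mxE => /eqP.
under eq_bigr do rewrite [(_^T)%R _ _]mxE -expr2.
rewrite psumr_eq0 => [/allP x0|i _]; last exact: sqr_ge0.
apply/rowP => k; rewrite [RHS]mxE; apply/eqP.
by rewrite -sqrf_eq0; apply: x0; rewrite mem_index_enum.
Qed.

(** A subspace and its orthogonal complement meet trivially, which is what gives
    [proj_mx] in [eigenproj] its meaning. *)
Lemma cap_orthogonal (W : 'M[R]_n) : (W :&: kermx W^T)%MS = 0.
Proof.
apply/eqP; rewrite -submx0; apply/rV_subP => x; rewrite sub_capmx submx0.
case/andP=> /submxP[y xyW] /sub_kermxP xW0.
by apply/eqP/row_mul_tr_eq0; rewrite {2}xyW trmx_mul mulmxA xW0 mul0mx.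
Qed.

Lemma eigenproj_id m (A : 'M[R]_(m, n)) lam :
  A *m N = lam *: A -> A *m eigenproj N lam = A.
Proof.
by move=> AN; apply: proj_mx_id; [apply: cap_orthogonal | apply/eigenspaceP].
Qed.

Lemma eigenproj_eigen lam : eigenproj N lam *m N = lam *: eigenproj N lam.
Proof. by apply/eigenspaceP; rewrite -[eigenproj _ _]mul1mx proj_mx_sub. Qed.

(** Eigenvectors for distinct eigenvalues are orthogonal, so the rows of [A] lie in
    the complement along which [eigenproj N mu] projects. *)
Lemma eigenproj_other m (A : 'M[R]_(m, n)) lam mu :
  A *m N = lam *: A -> lam != mu -> A *m eigenproj N mu = 0.
Proof.
move=> AN neq; apply: proj_mx_0; first exact: cap_orthogonal.
apply/sub_kermxP; set W := eigenspace N mu.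
have WN : W *m N = mu *: W by apply/eigenspaceP.
have : (lam - mu) *: (A *m W^T) = 0.
  rewrite scalerBl scalemxAl -AN -mulmxA -{1}symN -trmx_mul WN linearZ /=.
  by rewrite -scalemxAr subrr.
by move/eqP; rewrite scaler_eq0 subr_eq0 (negPf neq) => /eqP.
Qed.

Lemma eigenproj_eq0 lam : ~~ eigenvalue N lam -> eigenproj N lam = 0.
Proof.
rewrite negbK => /eqP W0; apply/eqP; rewrite -submx0 -W0.
by rewrite -[eigenproj _ _]mul1mx proj_mx_sub.
Qed.

(** The complexification of [N] is Hermitian, hence unitarily diagonalizable with
    real eigenvalues; as the rank of a matrix does not change under field
    extension, the real eigenspaces already span. *)
Lemma symmetric_eigenspaces_span : exists d : 'rV[R]_n,
  (1%:M <= \sum_i eigenspace N (d 0 i))%MS.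
Proof.
pose C : numClosedFieldType := R[i].
pose toC : {rmorphism R -> C} := real_complex R.
pose M := map_mx toC N.
have MH : M \is hermsymmx.
  apply/is_hermitianmxP; rewrite expr0 scale1r; apply/matrixP => i j.
  rewrite !mxE -[in LHS]symN mxE; apply/esym/CrealP.
  by rewrite complex_real.
have /hermitian_normalmx/orthomx_spectralP := MH.
have := hermitian_spectral_diag_real MH; have := spectral_unit M.
set P := spectralmx M; set d := spectral_diag M => Pu dR ME.
have PM : P *m M = diag_mx d *m P by rewrite ME !mulmxA mulmxV // mul1mx.
exists (map_mx (@complex.Re R) d).
rewrite -(map_submx toC) map_mx1; set W := (\sum_i _)%MS.
apply: (@submx_trans _ _ _ _ _ _ P); first by rewrite sub1mx row_full_unit.
apply/row_subP => i.
apply: (@submx_trans _ _ _ _ _ _ (eigenspace M (d 0 i))).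
  by apply/eigenspaceP; rewrite -row_mul PM row_mul row_diag_mx -scalemxAl -rowE.
have dE : d 0 i = toC (map_mx (@complex.Re R) d 0 i).
  by rewrite mxE; apply/esym/RRe_real; move/mxOverP: dR; apply.
by rewrite dE -map_eigenspace map_submx (sumsmx_sup i).
Qed.

(** With [s] listing each eigenvalue once, a vector of an eigenspace is fixed by one
    summand and killed by the others, and the eigenspaces span. *)
Lemma sum_eigenproj : exists s : seq R,
  \sum_(lam <- s) eigenproj N lam = 1%:M.
Proof.
have [d full] := symmetric_eigenspaces_span.
exists (undup [seq d 0 i | i : 'I_n]).
have /sub_sumsmxP[u uE] := full.
rewrite -[LHS]mul1mx [X in X *m _]uE mulmx_suml [RHS]uE.
apply: eq_bigr => i _; rewrite mulmx_sumr.
have eig : u i *m eigenspace N (d 0 i) *m N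
    = d 0 i *: (u i *m eigenspace N (d 0 i)).
  by apply/eigenspaceP; apply: submxMl.
rewrite (bigD1_seq (d 0 i)) ?undup_uniq //=; last first.
  by rewrite mem_undup; apply: image_f.
rewrite (eigenproj_id eig) big1 ?addr0 // => lam neq.
by rewrite (eigenproj_other eig) // eq_sym.
Qed.

End SymmetricMatrices.

Section Projections.
Variables (R : realType) (V : finType) (M : 'M[R]_#|V|).

Lemma eproj_eq0 lam v :
  ~~ eigenvalue M lam -> eproj M lam v = 0.
Proof. by rewrite /eproj => /eigenproj_eq0 ->; rewrite mulmx0. Qed.

Lemma eigsuppE v lam :
  eigsupp M v lam = (eproj M lam v != 0).
Proof.
rewrite /eigsupp; case: (boolP (eigenvalue M lam)) => //= /eproj_eq0 ->.
by rewrite eqxx.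
Qed.

(** If [E_lam e_u] vanishes then so does [E_lam e_v], both being equal up to
    sign; this is why the supports of [u] and [w] alone suffice to define the
    sets of eigenvalues that matter. *)
Lemma strongly_cospectral_eproj0 u v lam :
  strongly_cospectral M u v -> eproj M lam u = 0 -> eproj M lam v = 0.
Proof.
move=> uv u0; case: (boolP (eigenvalue M lam)) => [/uv|/eproj_eq0-> //].
by rewrite u0; case=> [<-|/eqP] //; rewrite eq_sym oppr_eq0 => /eqP.
Qed.

End Projections.

(** * Kronecker products indexed by pairs of vertices *)

Section Kronecker.
Variables (R : realType) (VX VY : finType).
Implicit Types (x : 'rV[R]_#|VX|) (y : 'rV[R]_#|VY|).

(** Matrices of a product graph are indexed by [enum_rank] of a pair of vertices,
    those of [*t] by the rank of a pair of ranks; the two orders are unrelated, and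
    [pair_index] is the bijection from the former to the latter. *)
Definition pair_index (k : 'I_#|{: VX * VY}|) : 'I_(#|VX| * #|VY|) :=
  mxtens_index (enum_rank (enum_val k).1, enum_rank (enum_val k).2).

Lemma pair_index_bij : bijective pair_index.
Proof.
exists (fun k => enum_rank (enum_val (mxtens_unindex k).1,
                            enum_val (mxtens_unindex k).2)) => k.
  by rewrite mxtens_indexK /= !enum_rankK -surjective_pairing enum_valK.
by case: (mxtens_indexP k) => i j; rewrite mxtens_indexK /pair_index
  enum_rankK /= !enum_valK.
Qed.

Definition kronv x y : 'rV[R]_#|{: VX * VY}| := colsub pair_index (x *t y).

Definition kronmx (A : 'M[R]_#|VX|) (B : 'M[R]_#|VY|) : 'M[R]_#|{: VX * VY}| :=
  mxsub pair_index pair_index (A *t B).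

Lemma kronvE x y k :
  kronv x y 0 k = x 0 (enum_rank (enum_val k).1) * y 0 (enum_rank (enum_val k).2).
Proof. by rewrite !mxE mxtens_indexK; congr (x _ _ * y _ _); apply: val_inj. Qed.

Lemma kronmxE A B k l :
  kronmx A B k l = A (enum_rank (enum_val k).1) (enum_rank (enum_val l).1) *
                   B (enum_rank (enum_val k).2) (enum_rank (enum_val l).2).
Proof. by rewrite !mxE !mxtens_indexK. Qed.

Lemma colsub_mul m (z : 'M[R]_(m, #|VX| * #|VY|)) (M : 'M[R]_(#|VX| * #|VY|)) :
  colsub pair_index z *m mxsub pair_index pair_index M
    = colsub pair_index (z *m M).
Proof.
apply/matrixP => i j; rewrite !mxE [RHS](reindex pair_index) /=.
  by apply: eq_bigr => k _; rewrite !mxE.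
exact: onW_bij pair_index_bij.
Qed.

Lemma kronv_mul x y A B : kronv x y *m kronmx A B = kronv (x *m A) (y *m B).
Proof. by have := colsub_mul (x *t y) (A *t B); rewrite tensmx_mul. Qed.

Lemma kronmx_mul A B C D :
  kronmx A B *m kronmx C D = kronmx (A *m C) (B *m D).
Proof.
rewrite /kronmx -tensmx_mul; apply/matrixP => i j.
have /matrixP/(_ (pair_index i) j) := colsub_mul (A *t B) (C *t D).
by rewrite !mxE => <-; apply: eq_bigr => k _; rewrite !mxE.
Qed.

Lemma kronmx1 : kronmx 1%:M 1%:M = 1%:M.
Proof.
apply/matrixP => i j; rewrite kronmxE !mxE -natrM mulnb.
rewrite !(inj_eq enum_rank_inj) -(inj_eq enum_val_inj i j).
by case: (enum_val i) (enum_val j) => [a b] [c d].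
Qed.

Lemma kronmx_tr A B : (kronmx A B)^T = kronmx A^T B^T.
Proof. by apply/matrixP => i j; rewrite [LHS]mxE !kronmxE !mxE. Qed.

Lemma kronmxZl c A B : kronmx (c *: A) B = c *: kronmx A B.
Proof. by apply/matrixP => i j; rewrite [RHS]mxE !kronmxE !mxE mulrA. Qed.

Lemma kronmxZr c A B : kronmx A (c *: B) = c *: kronmx A B.
Proof. by apply/matrixP => i j; rewrite [RHS]mxE !kronmxE !mxE mulrCA. Qed.

Lemma kronmx_sum I J (r : seq I) (s : seq J) F G :
  kronmx (\sum_(i <- r) F i) (\sum_(j <- s) G j)
    = \sum_(i <- r) \sum_(j <- s) kronmx (F i) (G j).
Proof.
apply/matrixP => k l; rewrite kronmxE !summxE big_distrl.
apply: eq_bigr => i _; rewrite big_distrr summxE.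
by apply: eq_bigr => j _; rewrite kronmxE.
Qed.

Lemma kronv0l y : kronv 0 y = 0.
Proof. by apply/rowP => k; rewrite kronvE !mxE mul0r. Qed.

Lemma kronv0r x : kronv x 0 = 0.
Proof. by apply/rowP => k; rewrite kronvE !mxE mulr0. Qed.

Lemma kronv_eq0 x y : kronv x y = 0 -> x = 0 \/ y = 0.
Proof.
move=> xy0; have [->|/rV0Pn[i xi]] := eqVneq x 0; [by left | right].
apply/rowP => j; apply/eqP; rewrite mxE.
have := congr1 (fun z : 'rV_ _ => z 0 (enum_rank (enum_val i, enum_val j))) xy0.
rewrite kronvE enum_rankK /= !enum_valK mxE => /eqP.
by rewrite mulf_eq0 (negPf xi).
Qed.

Lemma kronvBZl c x x' y : kronv (x - c *: x') y = kronv x y - c *: kronv x' y.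
Proof.
by apply/rowP => k; rewrite kronvE !mxE !mxtens_indexK !ord1 mulrBl mulrA.
Qed.

Lemma kronv_tens x y x' y' c :
  kronv x y = c *: kronv x' y' <-> x *t y = c *: (x' *t y').
Proof.
split=> [E|E]; last first.
  by rewrite /kronv E; apply/rowP => k; rewrite !mxE.
have [g gK Kg] := pair_index_bij.
apply/matrixP => i k; have := congr1 (fun z : 'rV_ _ => z 0 (g k)) E.
by rewrite /kronv !mxE Kg !ord1.
Qed.

Lemma charvec_pair (u : VX) (w : VY) :
  charvec R (u, w) = kronv (charvec R u) (charvec R w).
Proof.
apply/rowP => k; rewrite kronvE !mxE eqxx /= -natrM mulnb.
rewrite !(inj_eq enum_rank_inj) -[k in LHS]enum_valK (inj_eq enum_rank_inj).
by case: (enum_val k).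
Qed.

End Kronecker.

(** * Spectral decomposition of a product *)

Section ProductSpectrum.
Variables (R : realType) (VX VY : finType).
Variables (NX : 'M[R]_#|VX|) (NY : 'M[R]_#|VY|) (N : 'M[R]_#|{: VX * VY}|).
Hypotheses (symX : NX^T = NX) (symY : NY^T = NY) (symN : N^T = N).
Variable f : R -> R -> R.
Hypothesis eigN : forall A B lam theta,
  A *m NX = lam *: A -> B *m NY = theta *: B ->
  kronmx A B *m N = f lam theta *: kronmx A B.

(** The rows of [E_lam (x) E_theta] are eigenvectors of [N], so multiplying by
    [E_mu] on the right either fixes them or kills them; all the matrices involved
    are symmetric, so transposition moves [E_mu] to the left. *)
Lemma eigenproj_kron mu lam theta :
  eigenproj N mu *m kronmx (eigenproj NX lam) (eigenproj NY theta)
    = (f lam theta == mu)%:R *: kronmx (eigenproj NX lam) (eigenproj NY theta).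
Proof.
set K := kronmx _ _.
have KT : K^T = K by rewrite kronmx_tr !eigenproj_sym.
have KN : K *m N = f lam theta *: K.
  by apply: eigN; apply: eigenproj_eigen.
rewrite -[LHS]trmxK trmx_mul KT eigenproj_sym.
have [<-|neq] := eqVneq (f lam theta) mu.
  by rewrite eigenproj_id // KT scale1r.
by rewrite (eigenproj_other symN KN neq) trmx0 scale0r.
Qed.

Lemma eproj_kron mu lam theta u w :
  eproj N mu (u, w) *m kronmx (eigenproj NX lam) (eigenproj NY theta)
    = (f lam theta == mu)%:R *: kronv (eproj NX lam u) (eproj NY theta w).
Proof.
by rewrite /eproj -mulmxA eigenproj_kron -scalemxAr charvec_pair kronv_mul.
Qed.

(** A vector is determined by its components, since the [E_lam (x) E_theta] sum to
    the identity. *)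
Lemma row_kron_eq0 (z : 'rV[R]_#|{: VX * VY}|) :
  (forall lam theta, z *m kronmx (eigenproj NX lam) (eigenproj NY theta) = 0) ->
  z = 0.
Proof.
move=> z0; have [[s sE] [t tE]] :=
  (sum_eigenproj symX, sum_eigenproj symY).
rewrite -[z]mulmx1 -kronmx1 -sE -tE kronmx_sum mulmx_sumr big1 // => i _.
by rewrite mulmx_sumr big1.
Qed.

(** The scalar [c] stands for either sign in the definition of strong
    cospectrality, so that the two cases need one proof. *)
Lemma eproj_pair_eq mu c u v w z :
  eproj N mu (u, w) = c *: eproj N mu (v, z) <->
  forall lam theta, f lam theta = mu ->
    kronv (eproj NX lam u) (eproj NY theta w)
      = c *: kronv (eproj NX lam v) (eproj NY theta z).
Proof.
split=> [E lam theta fE|E].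
  have := congr1 (mulmx^~ (kronmx (eigenproj NX lam) (eigenproj NY theta))) E.
  by rewrite -scalemxAl !eproj_kron fE eqxx !scale1r.
apply/eqP; rewrite -subr_eq0; apply/eqP/row_kron_eq0 => lam theta.
rewrite mulmxBl -scalemxAl !eproj_kron; case: eqP => [/E->|_].
  by rewrite !scale1r subrr.
by rewrite !scale0r scaler0 subrr.
Qed.

Lemma strongly_cospectral_pair u v w z :
  strongly_cospectral N (u, w) (v, z) <->
  forall mu, eigenvalue N mu ->
    (forall lam theta, f lam theta = mu ->
       kronv (eproj NX lam u) (eproj NY theta w)
         = 1 *: kronv (eproj NX lam v) (eproj NY theta z)) \/
    (forall lam theta, f lam theta = mu ->
       kronv (eproj NX lam u) (eproj NY theta w)
         = (-1) *: kronv (eproj NX lam v) (eproj NY theta z)).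
Proof.
split=> H mu /H; rewrite -!eproj_pair_eq scale1r scaleN1r; exact.
Qed.

(* [rel] is the relation in the form in which the sets [Lambda] and [Theta] use   *)
(* it; in the direct product it reads [f lam theta = mu] without division.        *)
Variable rel : R -> R -> R -> Prop.
Hypothesis relP : forall mu lam theta, rel mu lam theta <-> f lam theta = mu.

(** For [lam] in [Lambda] there is a partner [theta] with [E_theta e_w] nonzero, and
    this common tensor factor cancels.  Outside [Lambda] both sides are zero. *)
Lemma pair_eq_Lambda mu c u v w : strongly_cospectral NX u v ->
  (forall lam theta, f lam theta = mu ->
     kronv (eproj NX lam u) (eproj NY theta w)
       = c *: kronv (eproj NX lam v) (eproj NY theta w)) <->
  (forall lam, Lambda NX NY u w (rel mu) lam ->
     eproj NX lam u = c *: eproj NX lam v).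
Proof.
move=> uv; split=> [E lam [_ [theta]]|E lam theta fE].
  rewrite eigsuppE => w0 /relP/E/eqP; rewrite -subr_eq0 -kronvBZl => /eqP.
  case/kronv_eq0 => [/eqP|/eqP w0']; last by rewrite w0' in w0.
  by rewrite subr_eq0 => /eqP.
have [u0|u0] := eqVneq (eproj NX lam u) 0.
  by rewrite u0 (strongly_cospectral_eproj0 uv u0) kronv0l scaler0.
have [->|w0] := eqVneq (eproj NY theta w) 0; first by rewrite !kronv0r scaler0.
apply/eqP; rewrite -subr_eq0 -kronvBZl E ?subrr ?kronv0l //.
by split; [rewrite eigsuppE | exists theta; [rewrite eigsuppE | apply/relP]].
Qed.

(** A pair missing from the supports contributes zero on both sides: on the right
    because strongly cospectral vertices have the same support. *)
Lemma pair_eq_Lambda_Theta mu c u v w z :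
  strongly_cospectral NX u v -> strongly_cospectral NY w z ->
  (forall lam theta, f lam theta = mu ->
     kronv (eproj NX lam u) (eproj NY theta w)
       = c *: kronv (eproj NX lam v) (eproj NY theta z)) <->
  (forall lam theta,
     Lambda NX NY u w (rel mu) lam -> Theta NX NY u w (rel mu) theta ->
     rel mu lam theta ->
     eproj NX lam u *t eproj NY theta w
       = c *: (eproj NX lam v *t eproj NY theta z)).
Proof.
move=> uv wz; split=> [E lam theta _ _ /relP/E/kronv_tens // | E lam theta fE].
have [u0|u0] := eqVneq (eproj NX lam u) 0.
  by rewrite u0 (strongly_cospectral_eproj0 uv u0) !kronv0l scaler0.
have [w0|w0] := eqVneq (eproj NY theta w) 0.
  by rewrite w0 (strongly_cospectral_eproj0 wz w0) !kronv0r scaler0.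
apply/kronv_tens/E; last exact/relP.
  by split; [rewrite eigsuppE | exists theta; [rewrite eigsuppE | apply/relP]].
by split; [rewrite eigsuppE | exists lam; [rewrite eigsuppE | apply/relP]].
Qed.

Lemma strongly_cospectral_Lambda u v w : strongly_cospectral NX u v ->
  strongly_cospectral N (u, w) (v, w) ->
  forall mu, eigenvalue N mu ->
    (forall lam, Lambda NX NY u w (rel mu) lam ->
       eproj NX lam u = eproj NX lam v) \/
    (forall lam, Lambda NX NY u w (rel mu) lam ->
       eproj NX lam u = - eproj NX lam v).
Proof.
move=> uv /strongly_cospectral_pair uvw mu /uvw.
by case=> /(pair_eq_Lambda _ _ _ uv) E; [left | right] => lam /E ->;
  rewrite (scale1r, scaleN1r).
Qed.

(** If [mu] arises from a single [lam], then [Lambda] has at most one element and the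
    sign provided by the strong cospectrality of [u] and [v] at [lam] will do. *)
Lemma Lambda_strongly_cospectral u v w : strongly_cospectral NX u v ->
  (forall mu, eigenvalue N mu ->
    (exists2 lam, eigenvalue NX lam &
       forall lam' theta', eigenvalue NX lam' -> eigenvalue NY theta' ->
         rel mu lam' theta' -> lam' = lam) \/
    ((forall lam, Lambda NX NY u w (rel mu) lam ->
        eproj NX lam u = eproj NX lam v) \/
     (forall lam, Lambda NX NY u w (rel mu) lam ->
        eproj NX lam u = - eproj NX lam v))) ->
  strongly_cospectral N (u, w) (v, w).
Proof.
move=> uv H; apply/strongly_cospectral_pair => mu muN.
suff [E|E] : (forall lam, Lambda NX NY u w (rel mu) lam ->
        eproj NX lam u = eproj NX lam v) \/
     (forall lam, Lambda NX NY u w (rel mu) lam ->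
        eproj NX lam u = - eproj NX lam v).
- by left; apply/pair_eq_Lambda => // lam /E ->; rewrite scale1r.
- by right; apply/pair_eq_Lambda => // lam /E ->; rewrite scaleN1r.
case: (H mu muN) => // -[lam lamX uniq].
have Lambda1 lam' : Lambda NX NY u w (rel mu) lam' -> lam' = lam.
  by case=> /andP[lX _] [theta' /andP[tY _] /uniq->].
by have [E|E] := uv lam lamX; [left|right] => lam' /Lambda1 ->.
Qed.

Lemma strongly_cospectral_Lambda_Theta u v w z :
  strongly_cospectral NX u v -> strongly_cospectral NY w z ->
  strongly_cospectral N (u, w) (v, z) <->
  forall mu, eigenvalue N mu ->
    (forall lam theta,
       Lambda NX NY u w (rel mu) lam -> Theta NX NY u w (rel mu) theta ->
       rel mu lam theta ->
       eproj NX lam u *t eproj NY theta w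
         = eproj NX lam v *t eproj NY theta z) \/
    (forall lam theta,
       Lambda NX NY u w (rel mu) lam -> Theta NX NY u w (rel mu) theta ->
       rel mu lam theta ->
       eproj NX lam u *t eproj NY theta w
         = - (eproj NX lam v *t eproj NY theta z)).
Proof.
move=> uv wz; rewrite strongly_cospectral_pair.
split=> H mu /H [] E; [left|right|left|right].
- move=> lam theta lamL thT r.
  by rewrite (proj1 (pair_eq_Lambda_Theta _ _ uv wz) E) // scale1r.
- move=> lam theta lamL thT r.
  by rewrite (proj1 (pair_eq_Lambda_Theta _ _ uv wz) E) // scaleN1r.
- by apply/(pair_eq_Lambda_Theta _ _ uv wz) => lam theta *; rewrite scale1r E.
- by apply/(pair_eq_Lambda_Theta _ _ uv wz) => lam theta *; rewrite scaleN1r E.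
Qed.

End ProductSpectrum.

(** * Matrices of product graphs *)

Section GraphMatrices.
Variables (R : realType) (alpha beta gamma : R).

Lemma genadjmx_sym (V : finType) (X : wgraph R V) :
  (genadjmx alpha beta gamma X)^T = genadjmx alpha beta gamma X.
Proof.
apply/matrixP => i j; rewrite !mxE weightC [j == i]eq_sym.
by case: eqVneq => [->|].
Qed.

Lemma degE (V : finType) (X : wgraph R V) u :
  deg X u = X u u + \sum_j X u j.
Proof. by rewrite /deg [in RHS](bigD1 u) //= addrA -mulr2n mulr_natl. Qed.

(** The entries of [D^(-1/2) A D^(-1/2)] in real form: when all degrees are negative
    the two factors [-i] multiply to [-1], the common sign of the degrees.  The sign
    is read off at [u] only; writing it as [Num.sg] makes it multiplicative. *)
Definition normweight (V : finType) (X : wgraph R V) u v : R :=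
  X u v * (Num.sg (deg X u) *
    ((Num.sqrt `|deg X u|)^-1 * (Num.sqrt `|deg X v|)^-1)).

Lemma normadjmx_entry (V : finType) (X : wgraph R V) i j :
  degrees_same_sign X ->
  normadjmx alpha gamma X i j
    = alpha *+ (i == j) + gamma * normweight X (enum_val i) (enum_val j).
Proof.
move=> sX; apply: complexI; rewrite rmorphD rmorphMn !rmorphM /=.
have /matrixP/(_ i j) := normadjmxE alpha gamma sX; rewrite [LHS]mxE => ->.
rewrite /cnormadjmx /inv_sqrt_degmx mul_mx_diag mul_diag_mx !mxE.
congr (_ + _ * _); rewrite mulrAC mulrC; congr (_ * _).
rewrite /inv_sqrt_deg; case: sX => sX.
  by rewrite !sX !gtr0_norm // gtr0_sg // rmorph1 mul1r.
rewrite !ltNge !ltW //= mulrACA mulrNN -expr2 sqr_i ltr0_sg //.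
by rewrite rmorphN1.
Qed.

Lemma normweightC (V : finType) (X : wgraph R V) u v : degrees_same_sign X ->
  normweight X u v = normweight X v u.
Proof.
move=> sX; have -> : normweight X u v = X v u * (Num.sg (deg X v) *
    ((Num.sqrt `|deg X u|)^-1 * (Num.sqrt `|deg X v|)^-1)).
  rewrite /normweight weightC; congr (_ * (_ * _)).
  by case: sX => sX; [rewrite !gtr0_sg | rewrite !ltr0_sg].
by rewrite [X in _ * (_ * X)]mulrC.
Qed.

Lemma normadjmx_sym (V : finType) (X : wgraph R V) : degrees_same_sign X ->
  (normadjmx alpha gamma X)^T = normadjmx alpha gamma X.
Proof.
move=> sX; apply/matrixP => i j; rewrite mxE !normadjmx_entry //.
by rewrite [j == i]eq_sym normweightC.
Qed.

Variables (VX VY : finType) (X : wgraph R VX) (Y : wgraph R VY).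

Lemma deg_cartesian p :
  deg (cartesian_product X Y) p = deg X p.1 + deg Y p.2.
Proof.
case: p => a b; rewrite !degE /= /cartesian_weight /= !eqxx addrACA.
congr (_ + _); rewrite big_split /=; congr (_ + _).
  rewrite -(pair_bigA _ (fun c d => if b == d then X a c else 0)) /=.
  by apply: eq_bigr => c _; rewrite -big_mkcond (big_pred1 b).
rewrite -(pair_bigA _ (fun c d => if a == c then Y b d else 0)) exchange_big /=.
by apply: eq_bigr => d _; rewrite -big_mkcond (big_pred1 a).
Qed.

(** Each of the two Kronecker summands contributes [alpha] to the diagonal, hence the
    correction by [alpha]. *)
Lemma genadjmx_cartesian :
  genadjmx alpha beta gamma (cartesian_product X Y)
    = kronmx (genadjmx alpha beta gamma X) 1%:M
      + kronmx 1%:M (genadjmx alpha beta gamma Y) - alpha%:M.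
Proof.
apply/matrixP => k l; rewrite [RHS]mxE [X in _ = X + _]mxE !kronmxE !mxE.
rewrite !enum_rankK !(inj_eq enum_rank_inj) deg_cartesian.
rewrite -(inj_eq enum_val_inj k l) /= /cartesian_weight.
case: (enum_val k) (enum_val l) => [a b] [c d] /=; rewrite xpair_eqE.
by case: eqVneq => _; case: eqVneq => _ /=; rewrite ?mulr1n ?mulr0n; ring.
Qed.

Hypotheses (sX : simple_graph X) (sY : simple_graph Y).
Hypotheses (signX : degrees_same_sign X) (signY : degrees_same_sign Y).

Lemma normweight_direct p q :
  normweight (direct_product X Y) p q
    = normweight X p.1 q.1 * normweight Y p.2 q.2.
Proof.
rewrite /normweight !deg_direct // /= /direct_weight sgrM !normrM.
by rewrite !sqrtrM // !invfM; ring.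
Qed.

Lemma normadjmx_direct : gamma != 0 ->
  normadjmx alpha gamma (direct_product X Y)
    = alpha%:M + gamma^-1 *: kronmx (normadjmx alpha gamma X - alpha%:M)
                                    (normadjmx alpha gamma Y - alpha%:M).
Proof.
move=> gamma_neq0; apply/matrixP => k l.
rewrite [RHS]mxE [X in _ = _ + X]mxE kronmxE.
have subE (V : finType) (Z : wgraph R V) i j : degrees_same_sign Z ->
    (normadjmx alpha gamma Z - alpha%:M) i j
      = gamma * normweight Z (enum_val i) (enum_val j).
  by move=> sZ; rewrite mxE normadjmx_entry // !mxE addrAC subrr add0r.
rewrite !subE // !enum_rankK normadjmx_entry; last first.
  exact: direct_degrees_same_sign.
by rewrite normweight_direct mxE; field.
Qed.

End GraphMatrices.

Theorem theorem4p1 (R : realType) (alpha beta gamma : R) (gamma_neq0 : gamma != 0)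
    (VX VY : finType) (X : wgraph R VX) (Y : wgraph R VY)
    (Xconn : graph_connected X) (Yconn : graph_connected Y) (u v : VX) :
  let AX := genadjmx alpha beta gamma X in
  let AY := genadjmx alpha beta gamma Y in
  let AXY := genadjmx alpha beta gamma (cartesian_product X Y) in
  let NX := normadjmx alpha gamma X in
  let NY := normadjmx alpha gamma Y in
  let NXY := normadjmx alpha gamma (direct_product X Y) in
  [/\ (* 1. *)
      strongly_cospectral AX u v ->
      forall w : VY,
      strongly_cospectral AXY (u, w) (v, w) <->
      (forall mu, eigenvalue AXY mu ->
         (exists lam theta,
            [/\ eigenvalue AX lam, eigenvalue AY theta,
                mu + alpha = lam + theta &
                forall lam' theta', eigenvalue AX lam' -> eigenvalue AY theta' ->
                  lam != lam' -> theta != theta' ->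
                  lam + theta != lam' + theta'])
         \/
         ((forall lam, Lambda AX AY u w (cartesian_rel alpha mu) lam ->
             eproj AX lam u = eproj AX lam v) \/
          (forall lam, Lambda AX AY u w (cartesian_rel alpha mu) lam ->
             eproj AX lam u = - eproj AX lam v))),
      (* 2. *)
      simple_graph X -> simple_graph Y ->
      degrees_same_sign X -> degrees_same_sign Y ->
      strongly_cospectral NX u v ->
      forall w : VY,
      strongly_cospectral NXY (u, w) (v, w) <->
      (forall mu, eigenvalue NXY mu ->
         (exists lam theta,
            [/\ eigenvalue NX lam, eigenvalue NY theta,
                gamma * mu - alpha * gamma = (lam - alpha) * (theta - alpha) &
                forall lam' theta', eigenvalue NX lam' -> eigenvalue NY theta' ->
                  lam != lam' \/ theta != theta' ->
                  (lam - alpha) * (theta - alpha)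
                    != (lam' - alpha) * (theta' - alpha)])
         \/
         ((forall lam, Lambda NX NY u w (direct_rel alpha gamma mu) lam ->
             eproj NX lam u = eproj NX lam v) \/
          (forall lam, Lambda NX NY u w (direct_rel alpha gamma mu) lam ->
             eproj NX lam u = - eproj NX lam v))),
      (* 3, for the Cartesian product. *)
      strongly_cospectral AX u v ->
      forall w z : VY, strongly_cospectral AY w z ->
      strongly_cospectral AXY (u, w) (v, z) <->
      (forall mu, eigenvalue AXY mu ->
         (forall lam theta,
            Lambda AX AY u w (cartesian_rel alpha mu) lam ->
            Theta AX AY u w (cartesian_rel alpha mu) theta ->
            cartesian_rel alpha mu lam theta ->
            eproj AX lam u *t eproj AY theta w
              = eproj AX lam v *t eproj AY theta z)
         \/
         (forall lam theta,
            Lambda AX AY u w (cartesian_rel alpha mu) lam ->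
            Theta AX AY u w (cartesian_rel alpha mu) theta ->
            cartesian_rel alpha mu lam theta ->
            eproj AX lam u *t eproj AY theta w
              = - (eproj AX lam v *t eproj AY theta z))) &
      (* 3, for the direct product. *)
      simple_graph X -> simple_graph Y ->
      degrees_same_sign X -> degrees_same_sign Y ->
      strongly_cospectral NX u v ->
      forall w z : VY, strongly_cospectral NY w z ->
      strongly_cospectral NXY (u, w) (v, z) <->
      (forall mu, eigenvalue NXY mu ->
         (forall lam theta,
            Lambda NX NY u w (direct_rel alpha gamma mu) lam ->
            Theta NX NY u w (direct_rel alpha gamma mu) theta ->
            direct_rel alpha gamma mu lam theta ->
            eproj NX lam u *t eproj NY theta w
              = eproj NX lam v *t eproj NY theta z)
         \/
         (forall lam theta,
            Lambda NX NY u w (direct_rel alpha gamma mu) lam ->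
            Theta NX NY u w (direct_rel alpha gamma mu) theta ->
            direct_rel alpha gamma mu lam theta ->
            eproj NX lam u *t eproj NY theta w
              = - (eproj NX lam v *t eproj NY theta z)))].
Proof.
move=> AX AY AXY NX NY NXY.
have symAX : AX^T = AX := genadjmx_sym _ _ _ _.
have symAY : AY^T = AY := genadjmx_sym _ _ _ _.
have symAXY : AXY^T = AXY := genadjmx_sym _ _ _ _.
have eigAXY A B lam theta : A *m AX = lam *: A -> B *m AY = theta *: B ->
    kronmx A B *m AXY = (lam + theta - alpha) *: kronmx A B.
  move=> AE BE; rewrite /AXY genadjmx_cartesian mulmxBr mulmxDr !kronmx_mul.
  rewrite !mulmx1 AE BE kronmxZl kronmxZr mul_mx_scalar -scalerDl.
  by rewrite -scalerBl.
have cartP mu lam theta :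
    cartesian_rel alpha mu lam theta <-> lam + theta - alpha = mu.
  by rewrite /cartesian_rel; split=> [<-|<-]; ring.
have eigNXY : simple_graph X -> simple_graph Y ->
    degrees_same_sign X -> degrees_same_sign Y ->
    forall A B lam theta, A *m NX = lam *: A -> B *m NY = theta *: B ->
    kronmx A B *m NXY
      = (alpha + gamma^-1 * ((lam - alpha) * (theta - alpha))) *: kronmx A B.
  move=> sX sY signX signY A B lam theta AE BE.
  rewrite /NXY normadjmx_direct // mulmxDr mul_mx_scalar -scalemxAr kronmx_mul.
  rewrite !mulmxBr !mul_mx_scalar AE BE -!scalerBl kronmxZl kronmxZr.
  by rewrite !scalerA -scalerDl mulrA.
have directP mu lam theta : direct_rel alpha gamma mu lam theta <->
    alpha + gamma^-1 * ((lam - alpha) * (theta - alpha)) = mu.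
  by rewrite /direct_rel; split=> [<-|<-]; field.
split.
- move=> uv w; split=> [uvw mu muN | H].
    by right; apply: (strongly_cospectral_Lambda symAX symAY symAXY eigAXY).
  apply: (Lambda_strongly_cospectral symAX symAY symAXY eigAXY cartP uv).
  move=> mu /H[[lam [theta [lamX thetaY muE uniq]]]|]; [left | by right].
  exists lam => // lam' theta' lX tY.
  rewrite /cartesian_rel muE => E.
  (* In a sum, one common term forces the other to agree. *)
  have [//|Nl] := eqVneq lam lam'.
  have [Et|Nt] := eqVneq theta theta'; first by move: E; rewrite Et => /addIr.
  by have := uniq _ _ lX tY Nl Nt; rewrite E eqxx.
- move=> sX sY signX signY uv w.
  have symNX : NX^T = NX := normadjmx_sym _ _ signX.
  have symNY : NY^T = NY := normadjmx_sym _ _ signY.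
  have symNXY : NXY^T = NXY.
    by apply: normadjmx_sym; apply: direct_degrees_same_sign.
  have eigN := eigNXY sX sY signX signY.
  split=> [uvw mu muN | H].
    by right; apply: (strongly_cospectral_Lambda symNX symNY symNXY eigN).
  apply: (Lambda_strongly_cospectral symNX symNY symNXY eigN directP uv).
  move=> mu /H[[lam [theta [lamX thetaY muE uniq]]]|]; [left | by right].
  exists lam => // lam' theta' lX tY.
  rewrite /direct_rel muE => E.
  have [//|Nl] := eqVneq lam lam'.
  by have := uniq _ _ lX tY (or_introl Nl); rewrite E eqxx.
- move=> uv w z wz.
  exact: (strongly_cospectral_Lambda_Theta symAX symAY symAXY eigAXY cartP).
- move=> sX sY signX signY uv w z wz.
  apply: (strongly_cospectral_Lambda_Theta _ _ _ (eigNXY sX sY signX signY));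
    rewrite ?normadjmx_sym //; exact: direct_degrees_same_sign.
Qed.
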